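(* Let $A$ be an associative Banach $D$-algebra with unit, $a=(a^i_j)$ an $n\times n$ matrix with entries in $A$, and $c=(c^1,\dots,c^n)^T$ a column with entries in $A$. The solution $x=(x^1,\dots,x^n)^T$, $x^i:\mathbb{R}\to A$, of the system of differential equations $$\frac{dx^i}{dt}=\sum_{k=1}^na^i_kx^k,\qquad i=1,\dots,n,$$ with initial condition $x(0)=c$ is $$x(t)=e^{ta_*{}^*}{}_*{}^*c .$$
   Context: $D$ is a complete commutative (normed) ring of characteristic $0$; real scalars act on $A$. The ${}_*{}^*$-product of matrices is $(p_*{}^*q)^i_j=\sum_kp^i_kq^k_j$ (upper index = row, lower index = column). The ${}_*{}^*$-powers of a square matrix $p$ are $p^{0_*{}^*}=E$ (unit matrix), $p^{m_*{}^*}=p^{(m-1)_*{}^*}{}_*{}^*p$. The ${}_*{}^*$-exponent is $e^{p_*{}^*}=\sum_{m=0}^\infty\frac1{m!}p^{m_*{}^*}$; $e^{ta_*{}^*}$ is the ${}_*{}^*$-exponent of the matrix $ta$. *)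

(* Defs.v *)
From HB Require Import structures.
From mathcomp Require Import all_boot all_order all_algebra.
From mathcomp Require Import all_classical all_reals all_analysis.

Set Implicit Arguments.
Unset Strict Implicit.
Unset Printing Implicit Defensive.

Import Order.TTheory GRing.Theory Num.Theory.
Import numFieldNormedType.Exports.

Local Open Scope classical_set_scope.
Local Open Scope ring_scope.

(* The hierarchy has no join of (possibly non-integral) rings with normed additive
   groups: such a join would have to be inserted below [numDomainType].  The two
   structures below therefore carry the ring operations as fields, and the ring
   and norm instances are then declared on their carriers.

   Norms of products are only required to be submultiplicative; multiplicative
   norms are a special case. *)
Record completeNormedComRing (R : realType) := CompleteNormedComRing {
  cncr_zmod : pseudoMetricNormedZmodType R ;
  cncr_one : cncr_zmod ;
  cncr_mul : cncr_zmod -> cncr_zmod -> cncr_zmod ;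
  cncr_mulA : associative cncr_mul ;
  cncr_mulC : commutative cncr_mul ;
  cncr_mul1r : left_id cncr_one cncr_mul ;
  cncr_mulDl : left_distributive cncr_mul +%R ;
  cncr_oner_neq0 : cncr_one != 0 ;
  cncr_normM : forall d e, `|cncr_mul d e| <= `|d| * `|e| ;
  cncr_complete : forall F : set_system cncr_zmod,
    ProperFilter F -> cauchy F -> cvg F
}.

Definition cncr_sort (R : realType) (D : completeNormedComRing R) : Type :=
  cncr_zmod D.
Coercion cncr_sort : completeNormedComRing >-> Sortclass.

Section CompleteNormedComRingInstances.
Context {R : realType} (D : completeNormedComRing R).

HB.instance Definition _ := PseudoMetricNormedZmod.copy (cncr_sort D) (cncr_zmod D).
HB.instance Definition _ := Uniform_isComplete.Build (cncr_sort D)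
  (@cncr_complete R D).
HB.instance Definition _ := GRing.Zmodule_isComNzRing.Build (cncr_sort D)
  (@cncr_mulA R D) (@cncr_mulC R D) (@cncr_mul1r R D) (@cncr_mulDl R D)
  (@cncr_oner_neq0 R D).

End CompleteNormedComRingInstances.

(* The canonical scaling [*:] of a Banach D-algebra is the action of the real
   scalars, which the derivative and the coefficients 1/m! use; the action of D
   is the separate operation [dscale]. *)
Record banachAlgebra (R : realType) (D : completeNormedComRing R) :=
  BanachAlgebra {
  ba_mod : completeNormedModType R ;
  ba_one : ba_mod ;
  ba_mul : ba_mod -> ba_mod -> ba_mod ;
  ba_mulA : associative ba_mul ;
  ba_mul1r : left_id ba_one ba_mul ;
  ba_mulr1 : right_id ba_one ba_mul ;
  ba_mulDl : left_distributive ba_mul +%R ;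
  ba_mulDr : right_distributive ba_mul +%R ;
  ba_oner_neq0 : ba_one != 0 ;
  ba_normM : forall x y, `|ba_mul x y| <= `|x| * `|y| ;
  ba_scaleAl : forall (r : R) x y, r *: ba_mul x y = ba_mul (r *: x) y ;
  ba_scaleAr : forall (r : R) x y, r *: ba_mul x y = ba_mul x (r *: y) ;
  dscale : D -> ba_mod -> ba_mod ;
  dscaleA : forall d e x, dscale d (dscale e x) = dscale (d * e) x ;
  dscale1 : forall x, dscale 1 x = x ;
  dscaleDr : forall d x y, dscale d (x + y) = dscale d x + dscale d y ;
  dscaleDl : forall d e x, dscale (d + e) x = dscale d x + dscale e x ;
  dscaleAl : forall d x y, dscale d (ba_mul x y) = ba_mul (dscale d x) y ;
  dscaleAr : forall d x y, dscale d (ba_mul x y) = ba_mul x (dscale d y) ;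
  dscaleC : forall d (r : R) x, dscale d (r *: x) = r *: dscale d x ;
  dscale_norm : forall d x, `|dscale d x| <= `|d| * `|x|
}.

Definition ba_sort (R : realType) (D : completeNormedComRing R)
    (A : banachAlgebra D) : Type := ba_mod A.
Coercion ba_sort : banachAlgebra >-> Sortclass.

Section BanachAlgebraInstances.
Context {R : realType} {D : completeNormedComRing R} (A : banachAlgebra D).

HB.instance Definition _ := CompleteNormedModule.copy (ba_sort A) (ba_mod A).
HB.instance Definition _ := GRing.Zmodule_isNzRing.Build (ba_sort A)
  (@ba_mulA R D A) (@ba_mul1r R D A) (@ba_mulr1 R D A) (@ba_mulDl R D A)
  (@ba_mulDr R D A) (@ba_oner_neq0 R D A).
HB.instance Definition _ := GRing.LSemiModule_isLSemiAlgebra.Build R (ba_sort A)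
  (@ba_scaleAl R D A).
HB.instance Definition _ := GRing.LSemiAlgebra_isSemiAlgebra.Build R (ba_sort A)
  (@ba_scaleAr R D A).

End BanachAlgebraInstances.

Section MatrixExponential.
Context {R : realType} {D : completeNormedComRing R} {A : banachAlgebra D}.

(* The library's [*:] on 'M[A]_(m, n) only takes scalars in A. *)
Definition rscalemx m n (r : R) (p : 'M[A]_(m, n)) : 'M[A]_(m, n) :=
  map_mx (fun x : A => r *: x) p.

Definition expmx_coeff n (p : 'M[A]_n) (m : nat) : 'M[A]_n :=
  rscalemx (m`!%:R^-1) (p ^+ m).

(* The limit is taken entrywise, in the product topology of 'M[A]_n. *)
Definition expmx n (p : 'M[A]_n) : 'M[A]_n := limn (series (expmx_coeff p)).

Definition linear_ivp_solution n (a : 'M[A]_n) (c : 'cV[A]_n)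
    (x : R -> 'cV[A]_n) : Prop :=
  (forall (t : R) (i : 'I_n),
      is_derive t 1 (fun s : R => x s i 0) (\sum_(k < n) a i k * x t k 0))
  /\ x 0 = c.

End MatrixExponential.

(* Main.v *)
(* For the coefficients (a^m)_ij, bounded geometrically through the submultiplicative
   norm sum_ij |p_ij|, the series sum_m t^m/m! (a^m)_ij converges and its second-order
   Taylor remainder is O(h^2) by comparison with the real exponential; so
   E(t) = e^(ta) satisfies E' = aE = Ea, which gives existence.  For uniqueness, if x
   is a solution then s |-> E(T - s) x(s) has zero derivative, so its values E(T)c at 0
   and x(T) at T agree; no group law for E is needed. *)
Require Import Defs.
From HB Require Import structures.
From mathcomp Require Import all_boot all_order all_algebra.
From mathcomp Require Import all_classical all_reals all_analysis.
From mathcomp Require Import ring.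

Set Implicit Arguments.
Unset Strict Implicit.
Unset Printing Implicit Defensive.

Import Order.TTheory GRing.Theory Num.Theory.
Import numFieldNormedType.Exports.

Local Open Scope classical_set_scope.
Local Open Scope ring_scope.

(** * Derivatives of functions from the reals to a normed module *)

Section VectorValuedDerivative.
Context {R : realType} {V : normedModType R}.
Implicit Types (f : R -> V) (d : V) (t h : R).

Lemma is_derive_cvg f t d :
  (h^-1 *: (f (h + t) - f t) @[h --> 0^'] --> d) <-> is_derive t 1 f d.
Proof.
have E : (fun h => h^-1 *: ((f \o shift t) (h *: 1) - f t)) =
    (fun h => h^-1 *: (f (h + t) - f t)).
  by apply/funext => h /=; rewrite [_%:A]mulr1.
split=> [fd|[]].
  apply: DeriveDef; first by apply/cvg_ex; exists d; rewrite E.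
  by rewrite /derive E; apply: cvg_lim.
by rewrite /derivable /derive E => cf <-.
Qed.

(** Dividing by [h] turns the remainder into one of size at most [M * |h|], which tends to 0. The
    exponential is differentiated in this way, from a Taylor estimate. *)
Lemma is_derive_quadratic f t d M :
  (forall h, `|h| <= 1 -> `|f (h + t) - f t - h *: d| <= M * h ^+ 2) ->
  is_derive t 1 f d.
Proof.
move=> fd; apply/is_derive_cvg/cvgrPdist_le => e e0.
near=> h.
have h0 : h != 0 by near: h; exact: nbhs_dnbhs_neq.
have h1 : `|h| <= 1.
  near: h; apply: (@cvgr0_norm_le _ _ _ _ _ id) => //.
  exact: cvg_within.
have hM : M * `|h| <= e.
  rewrite (le_trans (ler_norm _))// normrM normr_id.
  (* [M] may be zero or negative, whereas [|M| + 1] can be divided by; it suffices that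
     [|h| <= e / (|M| + 1)]. *)
  have M1 : 0 < `|M| + 1 by rewrite ltr_wpDl.
  rewrite (@le_trans _ _ ((`|M| + 1) * `|h|))// ?ler_wpM2r ?lerDl//.
  rewrite mulrC -ler_pdivlMr//.
  near: h; apply: (@cvgr0_norm_le _ _ _ _ _ id) => //; last exact: divr_gt0.
  exact: cvg_within.
have {1}-> : d = h^-1 *: (h *: d) by rewrite scalerA mulVf// scale1r.
rewrite -scalerBr normrZ distrC normfV ler_pdivrMl ?normr_gt0//.
apply: le_trans (fd h h1) _.
by rewrite -real_normK ?num_real// expr2 mulrCA ler_wpM2l.
Unshelve. all: by end_near. Qed.

Lemma is_derive_continuous f t d :
  is_derive t 1 f d -> f (h + t) @[h --> 0^'] --> f t.
Proof.
move=> [/derivable1_diffP/differentiable_continuous fc _].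
have : h + t @[h --> 0^'] --> t.
  rewrite -[X in _ --> X]add0r; apply: cvgD; last exact: cvg_cst.
  exact: cvg_within.
by move=> ht; exact: (cvg_comp _ _ ht fc).
Qed.

End VectorValuedDerivative.

(* The norm [`|f s - f u|] is a real function with zero derivative in [s]. *)
Lemma is_derive0_cst (R : realType) (V : normedModType R) (f : R -> V) t u :
  (forall s : R, is_derive s 1 f 0) -> f t = f u.
Proof.
move=> f0; pose g s := `|f s - f u| : R.
suff : g t = g u.
  by rewrite /g subrr normr0 => /eqP; rewrite normr_eq0 subr_eq0 => /eqP.
apply: is_derive_0_is_cst => s; apply/(@is_derive_cvg R R).
have /(proj2 (is_derive_cvg _ _ _))/cvg_norm := f0 s; rewrite normr0 => fs.
(* By the reverse triangle inequality the difference quotient of [g] is bounded by the norm of that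
   of [f]. *)
apply: norm_cvg0; apply: (squeeze_cvgr _ (cvg_cst 0) fs).
near=> h; rewrite normr_ge0 /= !normrZ ler_wpM2l//.
by rewrite (le_trans (ler_dist_dist _ _))// opprB addrA subrK.
Unshelve. all: by end_near. Qed.

(** * Exponential generating functions of geometrically bounded sequences *)

Section ExponentialSeries.
Context {R : realType} {V : completeNormedModType R}.
Implicit Types (u : nat -> V) (t h K C : R).

(** For [u m] the (i, j) entry of [a ^+ m], the sum of these terms is the (i, j) entry of the
    exponential of [ta]. Differentiation in [t] becomes the shift of [u]. *)
Definition exp_genfun_coeff u t (m : nat) : V := exp_coeff t m *: u m.

Definition exp_genfun u t : V := limn (series (exp_genfun_coeff u t)).

Definition geometric_bound C K u := forall m, `|u m| <= C * K ^+ m.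

(** Comparison with [C] times the real exponential series, then completeness of [V]. The convergence
    part makes the exponential exist; the norm bound controls its Taylor remainder. *)
Lemma exp_majorant C (v : nat -> V) x :
  (forall m, `|v m| <= C * exp_coeff x m) ->
  cvgn (series v) /\ `|limn (series v)| <= C * expR x.
Proof.
move=> vle.
have cexp : series (fun m => C * exp_coeff x m) @ \oo --> C * expR x.
  rewrite (_ : series _ = fun k => C * series (exp_coeff x) k); last first.
    by apply/funext => k; rewrite /series/= mulr_sumr.
  by apply: cvgM; [exact: cvg_cst|exact: is_cvg_series_exp_coeff].
have cexp' : cvgn (series (fun m => C * exp_coeff x m)).
  by apply/cvg_ex; exists (C * expR x).
have cn : cvgn [normed series v].
  by apply: series_le_cvg cexp' => m; rewrite ?vle ?(le_trans (normr_ge0 _) (vle m))/=.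
split; first exact: normed_cvg.
rewrite (le_trans (lim_series_norm cn))// -(cvg_lim _ cexp)//.
exact: lim_series_le.
Qed.

Lemma is_cvg_exp_genfun u C K t : geometric_bound C K u ->
  cvgn (series (exp_genfun_coeff u t)).
Proof.
move=> uCK; apply: (proj1 (@exp_majorant C _ (`|t| * K) _)) => m.
rewrite normrZ /exp_coeff /= normrM normrX normfV [`|_%:R|]ger0_norm//.
have -> : C * ((`|t| * K) ^+ m / m`!%:R) = `|t| ^+ m / m`!%:R * (C * K ^+ m).
  by rewrite exprMn; ring.
by rewrite ler_wpM2l// divr_ge0.
Qed.

(** The remainder [Q m] satisfies [Q (m+1) = (h + t) * Q m + h^2 * m * t^(m-1)]. By induction each
    summand is at most [h^2 * r * (2r)^m], and together they give [h^2 * (2r)^(m+1)]. At [m = 0] the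
    truncated exponent is harmless, its factor being 0. *)
Lemma expr_taylor2 (r t h : R) m : 1 <= r -> `|t| <= r -> `|h + t| <= r ->
  `|(h + t) ^+ m - t ^+ m - h * (m%:R * t ^+ m.-1)| <= h ^+ 2 * (2 * r) ^+ m.
Proof.
move=> r1 tr htr; have r0 : 0 <= r by apply: le_trans r1.
elim: m => [|m IH]; first by rewrite !mul0r mulr0 !expr0 subrr subr0 normr0 mulr1 sqr_ge0.
have -> : (h + t) ^+ m.+1 - t ^+ m.+1 - h * (m.+1%:R * t ^+ m.+1.-1) =
  (h + t) * ((h + t) ^+ m - t ^+ m - h * (m%:R * t ^+ m.-1)) +
  h ^+ 2 * (m%:R * t ^+ m.-1).
  case: m {IH} => [|m] /=; first by rewrite !expr0 !expr1; ring.
  by rewrite !exprS -!natr1; ring.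
rewrite (le_trans (ler_normD _ _))// (normrM (h + t)) (normrM (h ^+ 2))
  (ger0_norm (sqr_ge0 h)) (normrM m%:R).
have h1 : `|h + t| * `|(h + t) ^+ m - t ^+ m - h * (m%:R * t ^+ m.-1)|
    <= r * (h ^+ 2 * (2 * r) ^+ m) by exact: ler_pM.
(* Here [m <= 2^m] absorbs the factor [m], and [1 <= r] allows raising the exponent of [r]. *)
have h2 : `|m%:R : R| * `|t ^+ m.-1| <= r * (2 * r) ^+ m.
  have tm : `|t ^+ m.-1| <= r ^+ m.
    rewrite normrX (le_trans (lerXn2r _ _ _ tr)) ?nnegrE//.
    by rewrite ler_weXn2l// leq_pred.
  rewrite exprMn mulrCA ler_pM//.
    by rewrite normr_nat -natrX ler_nat ltnW// ltn_expl.
  rewrite -exprS (le_trans tm)// ler_weXn2l//.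
have -> : h ^+ 2 * (2 * r) ^+ m.+1 =
  r * (h ^+ 2 * (2 * r) ^+ m) + h ^+ 2 * (r * (2 * r) ^+ m).
  by rewrite (exprS (2 * r)); ring.
by rewrite lerD// ler_wpM2l// sqr_ge0.
Qed.

Lemma geometric_bound_shift u C K : geometric_bound C K u ->
  geometric_bound (C * K) K (fun m => u m.+1).
Proof. by move=> uCK m; rewrite -mulrA -exprS. Qed.

(** The term at 0 vanishes and [(m+1) / (m+1)! = 1 / m!], so the termwise derivative is the series
    of the shifted sequence, delayed by one index. *)
Lemma cvg_exp_genfun_deriv u C K t : geometric_bound C K u ->
  series (fun m => (m%:R * t ^+ m.-1 / m`!%:R) *: u m) @ \oo -->
  exp_genfun (fun m => u m.+1) t.
Proof.
move=> /geometric_bound_shift uCK.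
rewrite -cvg_shiftS /=.
suff -> : (fun k => series (fun m => (m%:R * t ^+ m.-1 / m`!%:R) *: u m) k.+1) =
    series (exp_genfun_coeff (fun m => u m.+1) t) by exact: is_cvg_exp_genfun uCK.
apply/funext => k.
rewrite /series /= big_nat_recl//= !mul0r scale0r add0r.
apply: eq_bigr => m _; congr (_ *: _).
rewrite /exp_coeff /= factS natrM invfM.
have : m.+1%:R != 0 :> R by rewrite pnatr_eq0.
by move=> m0; rewrite mulrA [m.+1%:R * _]mulrC mulfK.
Qed.

Lemma exp_genfun_taylor2 u C K t : geometric_bound C K u ->
  exists M, forall h, `|h| <= 1 ->
  `|exp_genfun u (h + t) - exp_genfun u t - h *: exp_genfun (fun m => u m.+1) t| <= M * h ^+ 2.
Proof.
(* This [r] bounds both [|t|] and [|h + t|] for [|h| <= 1]. The factor [(2r)^m] of the scalar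
   estimate and the bound [C * K^m] on [u m] combine into the series of [expR (2 * r * K)]. *)
move=> uCK; pose r : R := `|t| + 1; exists (C * expR (2 * r * K)) => h h1.
have r1 : 1 <= r by rewrite /r lerDr.
pose v m := exp_coeff (h + t) m *: u m - exp_coeff t m *: u m
  - h *: ((m%:R * t ^+ m.-1 / m`!%:R) *: u m).
have vcvg : series v @ \oo -->
    exp_genfun u (h + t) - exp_genfun u t - h *: exp_genfun (fun m => u m.+1) t.
  rewrite (_ : series v = fun k => series (exp_genfun_coeff u (h + t)) k -
     series (exp_genfun_coeff u t) k -
     h *: series (fun m => (m%:R * t ^+ m.-1 / m`!%:R) *: u m) k); last first.
    by apply/funext => k; rewrite /series /= !sumrB scaler_sumr.
  apply: cvgB; first by apply: cvgB; exact: is_cvg_exp_genfun uCK.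
  by apply: cvgZr; exact: cvg_exp_genfun_deriv uCK.
rewrite -(cvg_lim _ vcvg)// mulrAC.
apply: (proj2 (@exp_majorant (C * h ^+ 2) _ _ _)) => m.
rewrite /v scalerA -!(scalerBl _ _ (u m)) normrZ /exp_coeff /=.
have -> : (h + t) ^+ m / m`!%:R - t ^+ m / m`!%:R
    - h * (m%:R * t ^+ m.-1 / m`!%:R) =
   ((h + t) ^+ m - t ^+ m - h * (m%:R * t ^+ m.-1)) / m`!%:R by ring.
rewrite normrM normfV [`|_%:R|]ger0_norm//.
have -> : C * h ^+ 2 * ((2 * r * K) ^+ m / m`!%:R) =
   (h ^+ 2 * (2 * r) ^+ m / m`!%:R) * (C * K ^+ m).
  by rewrite !exprMn; ring.
apply: ler_pM => //.
rewrite ler_wpM2r ?invr_ge0// expr_taylor2//; first by rewrite /r lerDl.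
by rewrite (le_trans (ler_normD _ _))// addrC lerD2l.
Qed.

End ExponentialSeries.

(** * Limits and derivatives of products and finite sums in the algebra *)

Section BanachAlgebraCalculus.
Context {R : realType} {D : completeNormedComRing R} {A : banachAlgebra D}.

Lemma normM_le (x y : A) : `|x * y| <= `|x| * `|y|.
Proof. exact: ba_normM. Qed.

Lemma cvg_mul {T : Type} {F : set_system T} {FF : Filter F} (f g : T -> A)
  (a b : A) : f @ F --> a -> g @ F --> b -> f x * g x @[x --> F] --> a * b.
Proof.
move=> fa gb.
have f0 : `|f x - a| @[x --> F] --> (0 : R).
  by have := cvg_norm (cvgB fa (cvg_cst a)); rewrite subrr normr0; exact.
have g0 : `|g x - b| @[x --> F] --> (0 : R).
  by have := cvg_norm (cvgB gb (cvg_cst b)); rewrite subrr normr0; exact.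
apply: (proj1 (subr_cvg0 _ _)); apply: norm_cvg0.
have h0 : `|f x - a| * `|g x - b| + `|a| * `|g x - b| + `|f x - a| * `|b|
    @[x --> F] --> (0 : R).
  rewrite -[X in _ --> X](_ : 0 * 0 + `|a| * 0 + 0 * `|b| = 0).
    by apply: cvgD; [apply: cvgD|]; apply: cvgM => //; exact: cvg_cst.
  by rewrite mul0r mulr0 mul0r !addr0.
apply: (squeeze_cvgr _ (cvg_cst 0) h0).
near=> x; rewrite normr_ge0/=.
(* Every summand contains a factor tending to 0, so submultiplicativity of the norm suffices. *)
have -> : f x * g x - a * b =
    (f x - a) * (g x - b) + a * (g x - b) + (f x - a) * b.
  by rewrite -mulrDl subrK mulrBr mulrBl addrA subrK.
rewrite (le_trans (ler_normD _ _))// lerD ?normM_le//.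
by rewrite (le_trans (ler_normD _ _))// lerD ?normM_le.
Unshelve. all: by end_near. Qed.

(** The usual splitting of the difference quotient, with the order of factors kept since [A] need
    not be commutative; continuity of [g] at [t] handles the first summand. *)
Lemma is_derive_mul (f g : R -> A) (t : R) (df dg : A) :
  is_derive t 1 f df -> is_derive t 1 g dg ->
  is_derive t 1 (fun s => f s * g s) (df * g t + f t * dg).
Proof.
move=> df' dg'; apply/is_derive_cvg.
have -> : (fun h => h^-1 *: (f (h + t) * g (h + t) - f t * g t)) =
  (fun h => (h^-1 *: (f (h + t) - f t)) * g (h + t)
            + f t * (h^-1 *: (g (h + t) - g t))).
  apply/funext => h; rewrite -scalerAl -scalerAr -scalerDr; congr (_ *: _).
  by rewrite mulrBl mulrBr addrA subrK.
apply: cvgD; apply: cvg_mul; [exact/is_derive_cvg|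
  exact: is_derive_continuous| |exact/is_derive_cvg].
exact: cvg_cst.
Qed.

Lemma is_derive_sum_ord n (f : 'I_n -> R -> A) (t : R) (df : 'I_n -> A) :
  (forall k, is_derive t 1 (f k) (df k)) ->
  is_derive t 1 (fun s => \sum_(k < n) f k s) (\sum_(k < n) df k).
Proof.
move=> dfk; rewrite (_ : (fun s => _) = \sum_(k < n) f k); first exact: is_derive_sum.
by apply/funext => s; rewrite fct_sumE.
Qed.

Lemma cvg_sum_ord n (f : 'I_n -> nat -> A) (l : 'I_n -> A) :
  (forall k, f k @ \oo --> l k) ->
  \sum_(k < n) f k m @[m --> \oo] --> \sum_(k < n) l k.
Proof.
elim: n f l => [|n IH] f l fl.
  by rewrite big_ord0; under eq_cvg do rewrite big_ord0; exact: cvg_cst.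
rewrite big_ord_recl; under eq_cvg do rewrite big_ord_recl.
by apply: cvgD; [exact: fl|apply: IH => k; exact: fl].
Qed.

End BanachAlgebraCalculus.

(** * The matrix exponential: entries, convergence and derivatives *)

Section MatrixSeries.
Context {R : realType} {D : completeNormedComRing R} {A : banachAlgebra D}.

(** The sum of entry norms is submultiplicative, unlike their maximum, and so bounds powers
    geometrically. *)
Definition mx_norm1 n (p : 'M[A]_n) : R := \sum_i \sum_j `|p i j|.

Lemma mx_norm1_ge0 n (p : 'M[A]_n) : 0 <= mx_norm1 p.
Proof. by apply: sumr_ge0 => i _; apply: sumr_ge0. Qed.

Lemma entry_le_mx_norm1 n (p : 'M[A]_n) i j : `|p i j| <= mx_norm1 p.
Proof.
rewrite /mx_norm1 (bigD1 i)//= (bigD1 j)//= -addrA lerDl addr_ge0//.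
  exact: sumr_ge0.
by apply: sumr_ge0 => k _; apply: sumr_ge0.
Qed.

Lemma mx_norm1M n (p q : 'M[A]_n) : mx_norm1 (p *m q) <= mx_norm1 p * mx_norm1 q.
Proof.
rewrite /mx_norm1 mulr_suml; apply: ler_sum => i _.
rewrite mulr_suml.
apply: (@le_trans _ _ (\sum_j \sum_k `|p i k| * `|q k j|)).
  apply: ler_sum => j _; rewrite mxE (le_trans (ler_norm_sum _ _ _))//.
  by apply: ler_sum => k _; exact: normM_le.
rewrite exchange_big/=; apply: ler_sum => k _; rewrite -mulr_sumr.
(* Row [k] of [q] contributes at most the sum over all rows. *)
rewrite ler_wpM2l// [X in _ <= X](bigD1 k)//= lerDl.
by apply: sumr_ge0 => l _; apply: sumr_ge0.
Qed.

(** The constant is the norm of the unit matrix, which starts the induction at [m = 0] and is in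
    general not 1. *)
Lemma geometric_bound_expmx n (p : 'M[A]_n) i j :
  geometric_bound (mx_norm1 (1%:M : 'M[A]_n)) (mx_norm1 p) (fun m => (p ^+ m) i j).
Proof.
move=> m; apply: le_trans (entry_le_mx_norm1 _ _ _) _.
elim: m => [|m IH]; first by rewrite !expr0 mulr1.
by rewrite !exprSr mulrA (le_trans (mx_norm1M _ _))// ler_wpM2r// mx_norm1_ge0.
Qed.

Lemma rscalemxX n (t : R) (p : 'M[A]_n) m :
  rscalemx t p ^+ m = rscalemx (t ^+ m) (p ^+ m).
Proof.
elim: m => [|m IH]; first by rewrite !expr0; apply/matrixP => i j; rewrite [RHS]mxE scale1r.
rewrite !exprSr IH; apply/matrixP => i j; rewrite !mxE scaler_sumr.
by apply: eq_bigr => k _; rewrite !mxE -scalerAl -scalerAr scalerA.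
Qed.

Lemma expmx_coeffE n (t : R) (p : 'M[A]_n) m i j :
  expmx_coeff (rscalemx t p) m i j = exp_genfun_coeff (fun k => (p ^+ k) i j) t m.
Proof.
by rewrite /expmx_coeff rscalemxX !mxE scalerA /exp_genfun_coeff /exp_coeff /= mulrC.
Qed.

Lemma mx_entry_cvg m n (u : nat -> 'M[A]_(m, n)) (l : 'M[A]_(m, n)) :
  u @ \oo --> l <-> forall i j, u k i j @[k --> \oo] --> l i j.
Proof.
split=> [ul i j|ul].
  apply/cvgrPdist_lt => e e0.
  have : \forall k \near \oo, ball l e (u k) by exact: (ul _ (nbhsx_ballx l e e0)).
  by apply: filterS => k [_ /(_ i j)]; rewrite -ball_normE.
apply/cvg_ballP => e e0.
(* Finitely many entries, hence one threshold for all of them. *)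
have : \forall k \near \oo, forall i j, `|l i j - u k i j| < e.
  apply: filter_forall => i; apply: filter_forall => j.
  by move/cvgrPdist_lt: (ul i j); exact.
by apply: filterS => k lk; split => // i j; rewrite -ball_normE; exact: lk.
Qed.

Lemma cvg_series_expmx n (t : R) (p : 'M[A]_n) :
  series (expmx_coeff (rscalemx t p)) @ \oo -->
  \matrix_(i, j) exp_genfun (fun k => (p ^+ k) i j) t.
Proof.
apply/mx_entry_cvg => i j; rewrite mxE.
rewrite (_ : (fun k => _) = series (exp_genfun_coeff (fun k => (p ^+ k) i j) t)).
  exact: is_cvg_exp_genfun (geometric_bound_expmx p i j).
apply/funext => k; rewrite /series /= summxE.
by apply: eq_bigr => m _; rewrite expmx_coeffE.
Qed.

(** Uniqueness of limits is applied entry by entry, in [A]. *)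
Lemma expmxE n (t : R) (p : 'M[A]_n) i j :
  expmx (rscalemx t p) i j = exp_genfun (fun k => (p ^+ k) i j) t.
Proof.
have pc := @cvg_series_expmx n t p.
have limE : series (expmx_coeff (rscalemx t p)) @ \oo --> expmx (rscalemx t p).
  by apply/cvg_ex; eexists; exact: pc.
move: limE pc => /mx_entry_cvg/(_ i j) limE /mx_entry_cvg/(_ i j).
by rewrite mxE => pc; rewrite -(cvg_lim _ limE)// -(cvg_lim _ pc).
Qed.

Lemma expmx0 n (p : 'M[A]_n) : expmx (rscalemx 0 p) = 1%:M.
Proof.
apply/matrixP => i j; rewrite expmxE; apply: cvg_lim => //.
(* The empty partial sum is skipped; all later ones equal the term at [m = 0], since
   [0 ^+ 0 = 1]. *)
rewrite -cvg_shiftS/= (_ : (fun k => _) = cst (1%:M i j)); first exact: cvg_cst.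
apply/funext => k; rewrite /series /= big_nat_recl// big1 => [|m _].
  by rewrite addr0 /exp_genfun_coeff /exp_coeff /= !expr0 fact0 divr1 scale1r.
by rewrite /exp_genfun_coeff /exp_coeff /= expr0n mul0r scale0r.
Qed.

(** The left side is the derivative series. Writing [p ^+ k.+1] as [p * p ^+ k] and passing to the
    limit gives [E' = pE], the form needed for existence. *)
Lemma expmx_derivl n (t : R) (p : 'M[A]_n) i j :
  exp_genfun (fun k => (p ^+ k.+1) i j) t = \sum_l p i l * expmx (rscalemx t p) l j.
Proof.
apply: cvg_lim => //.
rewrite (_ : series _ = fun k =>
    \sum_l p i l * series (exp_genfun_coeff (fun k => (p ^+ k) l j) t) k).
  apply: cvg_sum_ord => l; apply: cvg_mul; first exact: cvg_cst.
  rewrite expmxE; exact: is_cvg_exp_genfun (geometric_bound_expmx p l j).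
apply/funext => k; rewrite /series /=.
under [RHS]eq_bigr do rewrite mulr_sumr.
rewrite exchange_big/=; apply: eq_bigr => m _.
rewrite /exp_genfun_coeff exprS mxE scaler_sumr.
by apply: eq_bigr => l _; rewrite scalerAr.
Qed.

(** The mirror factorization [p ^+ k * p] gives [E' = Ep], which uniqueness needs to bring [p] next
    to [x]. *)
Lemma expmx_derivr n (t : R) (p : 'M[A]_n) i j :
  exp_genfun (fun k => (p ^+ k.+1) i j) t = \sum_l expmx (rscalemx t p) i l * p l j.
Proof.
apply: cvg_lim => //.
rewrite (_ : series _ = fun k =>
    \sum_l series (exp_genfun_coeff (fun k => (p ^+ k) i l) t) k * p l j).
  apply: cvg_sum_ord => l; apply: cvg_mul; last exact: cvg_cst.
  rewrite expmxE; exact: is_cvg_exp_genfun (geometric_bound_expmx p i l).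
apply/funext => k; rewrite /series /=.
under [RHS]eq_bigr do rewrite mulr_suml.
rewrite exchange_big/=; apply: eq_bigr => m _.
rewrite /exp_genfun_coeff exprSr mxE scaler_sumr.
by apply: eq_bigr => l _; rewrite scalerAl.
Qed.

Lemma is_derive_expmx n (p : 'M[A]_n) (t : R) i j :
  is_derive t 1 (fun s => expmx (rscalemx s p) i j)
    (\sum_l p i l * expmx (rscalemx t p) l j).
Proof.
have [M HM] := exp_genfun_taylor2 t (geometric_bound_expmx p i j).
apply: (is_derive_quadratic (M := M)) => h /HM.
by rewrite !expmxE expmx_derivl.
Qed.

Lemma is_derive_expmx_rev n (p : 'M[A]_n) (T t : R) i j :
  is_derive t 1 (fun s => expmx (rscalemx (T - s) p) i j)
    (- \sum_l expmx (rscalemx (T - t) p) i l * p l j).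
Proof.
have [M HM] := exp_genfun_taylor2 (T - t) (geometric_bound_expmx p i j).
(* In place of a chain rule, the Taylor estimate at [T - t] is used with increment [- h]. *)
apply: (is_derive_quadratic (M := M)) => h h1.
have := HM (- h); rewrite normrN sqrrN => /(_ h1).
rewrite !expmxE expmx_derivr.
have -> : - h + (T - t) = T - (h + t) by rewrite opprD addrCA.
by rewrite scaleNr scalerN.
Qed.

End MatrixSeries.

(** * Convergence, existence and uniqueness for the initial value problem *)

Theorem theorem9p3p4 (R : realType) (D : completeNormedComRing R)
    (charD0 : forall k : nat, k.+1%:R != 0 :> D)
    (A : banachAlgebra D) (n : nat) (a : 'M[A]_n) (c : 'cV[A]_n) :
  (forall t : R, cvgn (series (expmx_coeff (rscalemx t a)))) /\
  (forall x : R -> 'cV[A]_n,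
     linear_ivp_solution a c x <->
     (forall t : R, x t = expmx (rscalemx t a) *m c)).
Proof.
split=> [t|x]; first by apply/cvg_ex; eexists; exact: cvg_series_expmx.
split=> [[dx x0] T|xE]; last first.
  split=> [t i|]; last by rewrite xE expmx0 mul1mx.
  rewrite (_ : (fun s => _) =
      fun s => \sum_k expmx (rscalemx s a) i k * c k 0); last first.
    by apply/funext => s; rewrite xE mxE.
  apply: is_derive_eq.
    apply: is_derive_sum_ord => k.
    by apply: is_derive_mul; first exact: is_derive_expmx.
  (* The constant [c] contributes derivative 0; the rest is [(aE)c = a(Ec)] in coordinates. *)
  under eq_bigr do rewrite /= mulr0 addr0 mulr_suml.
  rewrite exchange_big/=; apply: eq_bigr => l _.
  rewrite xE mxE mulr_sumr; apply: eq_bigr => k _.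
  by rewrite mulrA.
apply/matrixP => i j; rewrite ord1.
pose w s : A := \sum_k expmx (rscalemx (T - s) a) i k * x s k 0.
have -> : x T i 0 = w T.
  by rewrite -[x T]mul1mx mxE /w subrr expmx0.
have -> : (expmx (rscalemx T a) *m c) i 0 = w 0 by rewrite /w subr0 x0 mxE.
apply: is_derive0_cst => s; apply: is_derive_eq.
  apply: is_derive_sum_ord => k.
  by apply: is_derive_mul; first exact: is_derive_expmx_rev.
(* The derivative of [w] is row [i] of [-(Ea)x + E(ax)], with [E] taken at [T - s]; the two double
   sums cancel after exchanging summations and reassociating. *)
rewrite big_split/=; apply/eqP; rewrite addrC addr_eq0 -sumrN; apply/eqP.
under eq_bigr do rewrite /= mulr_sumr.
under [RHS]eq_bigr do rewrite mulNr opprK mulr_suml.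
rewrite exchange_big/=; apply: eq_bigr => l _; apply: eq_bigr => k _.
by rewrite mulrA.
Qed.
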